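(* Let $\mathcal{B}=\{u_1,\dots,u_N\}$ be an orthonormal basis of $\mathbb{K}^N$, with associated unitary matrix $U$, let $X\neq\{0\}$ be a Banach space over $\mathbb{K}$, and let $q\in[1,\infty]$. Then for every $f\in X^N$, $$\|\hat f\|_q\le\kappa_q(U^* )\,\|f\|_1,\qquad \|f\|_q\le\kappa_q(U)\,\|\hat f\|_1 .$$ In particular, for every $f\in X^N$, $$\|\hat f\|_\infty\le\|U\|_\infty\|f\|_1,\quad \|f\|_\infty\le\|U\|_\infty\|\hat f\|_1,\quad \|\hat f\|_2\le\|f\|_1,\quad \|f\|_2\le\|\hat f\|_1 .$$ Consequently, $\mathcal{F}:L^1(V,X)\to L^q(V,X)$ is a topological isomorphism, and its operator norm is $$\|\mathcal{F}\|_{1\to q}=\kappa_q(U^* ).$$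
   Context: $\mathbb{K}$ is $\mathbb{R}$ or $\mathbb{C}$, $N\ge 1$, $V=\{1,\dots,N\}$. An $X$-valued signal is a function $f:V\to X$, identified with $(f(1),\dots,f(N))\in X^N$. Norms: $\|f\|_p=\left(\sum_{n=1}^N\|f(n)\|^p\right)^{1/p}$ for $p\in[1,\infty)$ and $\|f\|_\infty=\max_{1\le n\le N}\|f(n)\|$; $L^p(V,X)$ denotes $X^N$ with $\|\cdot\|_p$. $U$ is the $N\times N$ unitary matrix whose $k$-th column is $u_k=(u_k(1),\dots,u_k(N))$, i.e. its entry in row $n$, column $k$ is $u_k(n)$; its $n$-th row is $u(n)=(u_1(n),\dots,u_N(n))$; $U^*$ is its conjugate transpose. Graph Fourier transform: $\mathcal{F}:X^N\to X^N$, $\mathcal{F}f=\hat f$, $\hat f(k)=\sum_{n=1}^N\overline{u_k(n)}f(n)$. Coherence: $\|U\|_\infty=\max_{k,n}|u_k(n)|$, and for $r\in[1,\infty]$, $\kappa_r(U)=\max_{1\le k\le N}\|u_k\|_r$, where $\|\cdot\|_r$ is the usual $\ell^r$ norm on $\mathbb{K}^N$ (maximum over columns); hence $\kappa_r(U^* )=\max_{1\le n\le N}\|u(n)\|_r$. A topological isomorphism is a linear bijection that is continuous with continuous inverse; $\|\cdot\|_{p\to q}$ is the operator norm from $L^p(V,X)$ to $L^q(V,X)$. *)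

(* Defs.v *)
From HB Require Import structures.
From mathcomp Require Import all_boot all_order all_algebra.
From mathcomp Require Import complex.
From mathcomp Require Import all_classical all_reals all_analysis.
From mathcomp Require Import ring.

Set Implicit Arguments.
Unset Strict Implicit.
Unset Printing Implicit Defensive.

Import Order.TTheory GRing.Theory Num.Theory.
Import numFieldNormedType.Exports.

Local Open Scope classical_set_scope.
Local Open Scope ring_scope.

Inductive scalar_kind := RealScalars | ComplexScalars.

Definition scalar_field (R : realType) (k : scalar_kind) : numFieldType :=
  match k with RealScalars => R | ComplexScalars => R[i] end.

Definition sconj (R : realType) (k : scalar_kind) :
    scalar_field R k -> scalar_field R k :=
  match k with RealScalars => id | ComplexScalars => @conjc R end.

Definition sre (R : realType) (k : scalar_kind) : scalar_field R k -> R :=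
  match k with RealScalars => id | ComplexScalars => @complex.Re R end.

Definition sreal (R : realType) (k : scalar_kind) : R -> scalar_field R k :=
  match k with RealScalars => id | ComplexScalars => fun x : R => x%:C%C end.

(* MathComp norms over a scalar field K take their values in K; [rnorm] is the
   same norm read in R. *)
Definition rnorm (R : realType) (k : scalar_kind)
  (E : normedZmodType (scalar_field R k)) (x : E) : R := sre `|x|.

(* Maxima of norms start from 0, which is harmless since norms are nonnegative.
   The value at p = -oo is irrelevant: only exponents p >= 1 are used. *)
Definition lpnorm (R : realType) (k : scalar_kind) (N : nat)
    (E : normedZmodType (scalar_field R k)) (p : \bar R) (f : 'I_N -> E) : R :=
  match p with
  | r%:E => (\sum_n rnorm (f n) `^ r) `^ r^-1
  | +oo%E => \big[Num.max/0]_n rnorm (f n)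
  | -oo%E => 0
  end.

Section RealNorm.
Context (R : realType) (k : scalar_kind).
Implicit Types E : normedModType (scalar_field R k).

Lemma srealK : cancel (@sreal R k) (@sre R k).
Proof. by case: k. Qed.

Lemma sreal0 : @sreal R k 0 = 0. Proof. by case: k. Qed.

Lemma srealD x y : @sreal R k (x + y) = sreal k x + sreal k y.
Proof. by case: k => //=; exact: rmorphD. Qed.

Lemma srealM x y : @sreal R k (x * y) = sreal k x * sreal k y.
Proof. by case: k => //=; exact: rmorphM. Qed.

Lemma ler_sreal x y : (@sreal R k x <= sreal k y) = (x <= y).
Proof. by case: k => //=; rewrite lecR. Qed.

Lemma rnormE (E : normedZmodType (scalar_field R k)) (x : E) :
  sreal k (rnorm x) = `|x|.
Proof.
rewrite /rnorm; have := normr_ge0 x; case: k E x => //= E x.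
by case: `|x| => a b; rewrite lecE /= => /andP[/eqP -> _].
Qed.

Lemma rnorm_ge0 (E : normedZmodType (scalar_field R k)) (x : E) : 0 <= rnorm x.
Proof. by rewrite -ler_sreal rnormE sreal0. Qed.

Lemma rnorm_eq0 (E : normedZmodType (scalar_field R k)) (x : E) :
  rnorm x = 0 -> x = 0.
Proof. by move=> x0; apply/normr0_eq0; rewrite -rnormE x0 sreal0. Qed.

Lemma ler_rnormD (E : normedZmodType (scalar_field R k)) (x y : E) :
  rnorm (x + y) <= rnorm x + rnorm y.
Proof. by rewrite -ler_sreal srealD !rnormE ler_normD. Qed.

Lemma rnormZ E (a : scalar_field R k) (x : E) :
  rnorm (a *: x) = rnorm a * rnorm x.
Proof. by apply: (can_inj srealK); rewrite srealM !rnormE normrZ. Qed.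

End RealNorm.

Section FiniteMinkowski.
Context (R : realType) (N : nat) (p : R) (p1 : 1 <= p).
Implicit Types a b : 'I_N -> R.

Let p0 : 0 < p. Proof. exact: lt_le_trans p1. Qed.

Let pn (a : 'I_N -> R) : R := (\sum_n a n `^ p) `^ p^-1.

Let pnK a : pn a `^ p = \sum_n a n `^ p.
Proof.
rewrite /pn -powRrM mulVf ?gt_eqF// powRr1//.
by apply: sumr_ge0 => n _; exact: powR_ge0.
Qed.

Let pn_eq0 a : (forall n, 0 <= a n) -> pn a = 0 -> forall n, a n = 0.
Proof.
move=> a0 pa n; have := pnK a; rewrite pa powR0 ?gt_eqF// => /esym/eqP.
rewrite psumr_eq0; last by move=> ? _; exact: powR_ge0.
by move=> /allP /(_ n (mem_index_enum _)) /= /eqP /powR_eq0_eq0.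
Qed.

Lemma finite_minkowski a b :
  (forall n, 0 <= a n) -> (forall n, 0 <= b n) ->
  (\sum_n (a n + b n) `^ p) `^ p^-1 <=
  (\sum_n a n `^ p) `^ p^-1 + (\sum_n b n `^ p) `^ p^-1.
Proof.
move=> a0 b0; rewrite -[leRHS]/(pn a + pn b).
have [A0|A0] := eqVneq (pn a) 0.
  rewrite A0 add0r le_eqVlt; apply/orP; left; apply/eqP; congr (_ `^ _).
  by apply: eq_bigr => n _; rewrite (pn_eq0 a0 A0) add0r.
have [B0|B0] := eqVneq (pn b) 0.
  rewrite B0 addr0 le_eqVlt; apply/orP; left; apply/eqP; congr (_ `^ _).
  by apply: eq_bigr => n _; rewrite (pn_eq0 b0 B0) addr0.
have {}A0 : 0 < pn a by rewrite lt_neqAle eq_sym A0 powR_ge0.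
have {}B0 : 0 < pn b by rewrite lt_neqAle eq_sym B0 powR_ge0.
have := pnK a; have := pnK b.
move: (pn a) (pn b) A0 B0 => A B A0 B0 BE AE.
have S0 : 0 < A + B by rewrite addr_gt0.
set t := A / (A + B).
have t0 : 0 <= t by rewrite divr_ge0// ltW.
have t1 : t <= 1 by rewrite ler_pdivrMr// mul1r lerDl ltW.
have tE : 1 - t = B / (A + B).
  by rewrite /t; field; rewrite gt_eqF.
suff H : \sum_n (a n + b n) `^ p <= (A + B) `^ p.
  rewrite (le_trans (ge0_ler_powR _ _ _ H)) ?invr_ge0 ?nnegrE ?powR_ge0
    ?(ltW p0)//.
    by apply: sumr_ge0 => n _; exact: powR_ge0.
  by rewrite -powRrM mulfV ?gt_eqF// powRr1// ltW.
have key n : (a n + b n) `^ p <= (A + B) `^ p *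
    (t * (a n `^ p / A `^ p) + (1 - t) * (b n `^ p / B `^ p)).
  have -> : a n + b n = (A + B) *
      (t * (a n / A) + (1 - t) * (b n / B)).
    by rewrite tE /t; field; rewrite !gt_eqF.
  have an0 : 0 <= a n / A by rewrite divr_ge0// ltW.
  have bn0 : 0 <= b n / B by rewrite divr_ge0// ltW.
  rewrite powRM ?(ltW S0)//; last first.
    by rewrite addr_ge0// mulr_ge0// subr_ge0.
  rewrite ler_pM2l ?powR_gt0//.
  have := @convex_powR R p p1 (Itv01 t0 t1) (a n / A) (b n / B).
  rewrite !inE/= !in_itv/= !andbT => /(_ an0 bn0).
  rewrite !convRE/= !powRM ?invr_ge0 ?(ltW A0) ?(ltW B0)//.
  by rewrite -!powR_inv1 ?powR_ge0 ?(ltW A0) ?(ltW B0)// -!powRrM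
     ![_ * -1]mulrC ![-1 * _]mulrC.
rewrite (le_trans (ler_sum _ (fun n _ => key n)))//.
rewrite -mulr_sumr ger_pMr ?powR_gt0// big_split/= -!mulr_sumr -!mulr_suml.
by rewrite -AE -BE !mulfV ?gt_eqF ?powR_gt0// !mulr1 addrC subrK.
Qed.

End FiniteMinkowski.

Section LpNorm.
Context (R : realType) (k : scalar_kind) (N : nat).
Context (X : normedModType (scalar_field R k)) (p : \bar R) (p1 : (1 <= p)%E).
Implicit Types f g : {ffun 'I_N -> X}.

Lemma ler_lpnormD f g : lpnorm p (f + g) <= lpnorm p f + lpnorm p g.
Proof.
case: p p1 => [r| |]//= r1.
- rewrite lee_fin in r1.
  apply: le_trans (finite_minkowski r1 (fun n => rnorm_ge0 (f n))
                                       (fun n => rnorm_ge0 (g n))).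
  have S0 (F : 'I_N -> R) : 0 <= \sum_n F n `^ r.
    by apply: sumr_ge0 => n _; exact: powR_ge0.
  have r0 : 0 <= r by exact: le_trans r1.
  apply: ge0_ler_powR; rewrite ?invr_ge0 ?nnegrE//.
  apply: ler_sum => n _; apply: ge0_ler_powR; rewrite ?nnegrE ?rnorm_ge0//.
    by rewrite addr_ge0 ?rnorm_ge0.
  by rewrite ffunE ler_rnormD.
- apply/bigmax_leP; split=> [|n _]; first by rewrite addr_ge0// bigmax_ge_id.
  rewrite ffunE (le_trans (ler_rnormD _ _))//.
  by apply: lerD; [exact: (le_bigmax _ (fun n => rnorm (f n)))|
                   exact: (le_bigmax _ (fun n => rnorm (g n)))].
Qed.

Lemma lpnormZ (a : scalar_field R k) f :
  lpnorm p (a *: f) = rnorm a * lpnorm p f.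
Proof.
case: p p1 => [r| |]//= r1.
- have r0 : 0 < r by rewrite lee_fin in r1; exact: lt_le_trans r1.
  under eq_bigr do rewrite ffunE rnormZ powRM ?rnorm_ge0//.
  rewrite -mulr_sumr powRM ?powR_ge0 ?sumr_ge0//; last first.
    by move=> n _; exact: powR_ge0.
  by rewrite -powRrM mulfV ?gt_eqF// powRr1 ?rnorm_ge0.
- under eq_bigr do rewrite ffunE rnormZ.
  elim/big_rec2: _ => [|n x y _ ->]; first by rewrite mulr0.
  by rewrite maxr_pMr ?rnorm_ge0.
Qed.

Lemma lpnorm_eq0 f : lpnorm p f = 0 -> f = 0.
Proof.
case: p p1 => [r| |]//= r1.
- move=> /powR_eq0_eq0/eqP; rewrite psumr_eq0; last first.
    by move=> n _; exact: powR_ge0.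
  move=> /allP f0; apply/ffunP => n; rewrite ffunE; apply: rnorm_eq0.
  by have /= /eqP/powR_eq0_eq0 := f0 n (mem_index_enum _).
- move=> f0; apply/ffunP => n; rewrite ffunE; apply: rnorm_eq0.
  apply/eqP; rewrite eq_le rnorm_ge0 andbT -f0.
  exact: (le_bigmax _ (fun n => rnorm (f n))).
Qed.

End LpNorm.

(* L^p(V, X): the space X^N of signals on V = {1, ..., N}, indexed here by 'I_N,
   normed by [lpnorm p]. *)
Definition Lp (R : realType) (k : scalar_kind) (N : nat)
  (X : normedModType (scalar_field R k)) (p : \bar R) (p1 : (1 <= p)%E) :
  Type :=
  {ffun 'I_N -> X}.

Section LpNormed.
Context (R : realType) (k : scalar_kind) (N : nat).
Context (X : normedModType (scalar_field R k)) (p : \bar R) (p1 : (1 <= p)%E).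
Local Notation L := (@Lp R k N X p p1).

HB.instance Definition _ := GRing.Lmodule.on L.

Let norm (f : L) : scalar_field R k := sreal k (lpnorm p f).

Let norm_triangle (f g : L) : norm (f + g) <= norm f + norm g.
Proof. by rewrite /norm -srealD ler_sreal; exact: ler_lpnormD. Qed.

Let norm_homogeneous (a : scalar_field R k) (f : L) :
  norm (a *: f) = `|a| * norm f.
Proof.
by rewrite /norm -rnormE -srealM; congr (sreal k _); exact: lpnormZ.
Qed.

Let norm_definite (f : L) : norm f = 0 -> f = 0.
Proof.
rewrite /norm -(sreal0 R k) => /(can_inj (@srealK R k)); exact: lpnorm_eq0.
Qed.

HB.instance Definition _ :=
  Lmodule_isNormed.Build (scalar_field R k) L
    norm_triangle norm_homogeneous norm_definite.

Lemma rnorm_Lp (f : L) : rnorm f = lpnorm p f.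
Proof. exact: srealK. Qed.

End LpNormed.
Arguments Lp {R k} N X {p} p1.

(* Valued in the extended reals, so that an unbounded operator has norm +oo. *)
Definition opnorm (R : realType) (k : scalar_kind)
    (E F : normedModType (scalar_field R k)) (T : E -> F) : \bar R :=
  ereal_sup [set (rnorm (T x))%:E | x in [set x : E | rnorm x <= 1]].

Definition topological_isomorphism (K : numFieldType) (E F : normedModType K)
    (T : E -> F) : Prop :=
  [/\ linear T, continuous T &
      exists S : F -> E, [/\ cancel T S, cancel S T & continuous S]].

Section GraphFourier.
Context (R : realType) (k : scalar_kind) (N : nat).
Local Notation K := (scalar_field R k).

Definition inner (v w : 'cV[K]_N) : K := \sum_n v n 0 * sconj (w n 0).

Definition orthonormal_basis (u : 'I_N -> 'cV[K]_N) : Prop :=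
  basis_of fullv [seq u j | j : 'I_N] /\
  forall i j, inner (u i) (u j) = (i == j)%:R.

Definition basis_matrix (u : 'I_N -> 'cV[K]_N) : 'M[K]_N :=
  \matrix_(n, j) u j n 0.

Definition adjoint (A : 'M[K]_N) : 'M[K]_N := map_mx (@sconj R k) A^T.

Definition gft (X : normedModType K) (u : 'I_N -> 'cV[K]_N)
    (f : {ffun 'I_N -> X}) : {ffun 'I_N -> X} :=
  [ffun j => \sum_n sconj (u j n 0) *: f n].

Definition coherence (A : 'M[K]_N) : R :=
  \big[Num.max/0]_n \big[Num.max/0]_j rnorm (A n j).

Definition kappa (r : \bar R) (A : 'M[K]_N) : R :=
  \big[Num.max/0]_j lpnorm r (fun n => A n j).

End GraphFourier.

(* Main.v *)
From HB Require Import structures.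
Require Import Defs.
From mathcomp Require Import all_boot all_order all_algebra.
From mathcomp Require Import complex.
From mathcomp Require Import all_classical all_reals all_analysis.

Import Order.TTheory GRing.Theory Num.Theory.
Import numFieldNormedType.Exports.
Local Open Scope ring_scope.

(** The Fourier transform is the action on X^N of the scalar matrix U^*, and
    its inverse is the action of U, since the orthonormality relations say
    U^* U = 1 and, for square matrices, this gives U U^* = 1. Everything is
    therefore a fact about the action f |-> A f of a scalar matrix A on X^N,
    studied in [mxact].

    Writing A f as the sum over j of (column j of A) scaled by f(j), the
    triangle inequality in L^q gives
      ||A f||_q <= sum_j ||A^j||_q ||f(j)|| <= kappa_q(A) ||f||_1
    ([lpnorm_mxact]). The bound is attained at a unit vector of X placed at the
    index of the column with the largest norm, so the operator norm of A from
    L^1 to L^q is exactly kappa_q(A) ([opnorm_mxact]). Applied to A = U^* and,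
    on the transform of f, to A = U, the bound gives both inequalities. The
    special cases q = oo and q = 2 come from kappa_oo(A) <= ||A||_oo
    ([kappa_infty]) and from the fact that the columns of a matrix with
    A^* A = 1 are unit vectors ([kappa2_le1]).

    Continuity in both directions follows from the same bound: on finitely many
    points ||f||_1 <= N ||f||_p, so every matrix acts continuously from L^p to
    L^q ([mxact_continuous]). *)

(** * Finite l^p norms *)

Lemma rnorm0 {R : realType} {k : scalar_kind}
    (E : normedZmodType (scalar_field R k)) : rnorm (0 : E) = 0.
Proof. by rewrite /rnorm normr0 -(sreal0 R k) srealK. Qed.

(** The two families may take values in different spaces: this lets a family of
    vectors be traded for a family of scalars in [lpnormZr]. *)
Lemma eq_lpnorm {R : realType} {k : scalar_kind} {N : nat}
    {E F : normedZmodType (scalar_field R k)} (p : \bar R)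
    {f : 'I_N -> E} {g : 'I_N -> F} :
  (forall n, rnorm (f n) = rnorm (g n)) -> lpnorm p f = lpnorm p g.
Proof.
move=> fg; case: p => [r| |] /=.
- congr (_ `^ _); apply: eq_bigr => n _; rewrite fg; reflexivity.
- apply: eq_bigr => n _; rewrite fg; reflexivity.
- reflexivity.
Qed.

Lemma lpnorm_ge0 {R : realType} {k : scalar_kind} {N : nat}
    {E : normedZmodType (scalar_field R k)} (p : \bar R) (f : 'I_N -> E) :
  0 <= lpnorm p f.
Proof. by case: p => [r| |] //=; [exact: powR_ge0 | exact: bigmax_ge_id]. Qed.

Lemma lpnorm0 {R : realType} {k : scalar_kind} {N : nat}
    {X : normedModType (scalar_field R k)} {p : \bar R} (p1 : (1 <= p)%E) :
  lpnorm p (0 : {ffun 'I_N -> X}) = 0.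
Proof.
rewrite -(scale0r (0 : {ffun 'I_N -> X})) lpnormZ//.
by rewrite rnorm0 mul0r.
Qed.

Lemma lpnorm1E {R : realType} {k : scalar_kind} {N : nat}
    {E : normedZmodType (scalar_field R k)} (f : 'I_N -> E) :
  lpnorm 1%E f = \sum_n rnorm (f n).
Proof.
rewrite /= invr1 powRr1; last by apply: sumr_ge0 => n _; exact: powR_ge0.
by apply: eq_bigr => n _; rewrite powRr1 // rnorm_ge0.
Qed.

(** Only the numbers |a n| |x| matter, so the fixed vector x can be replaced by
    the scalar |x|; the claim is then homogeneity of the norm of the scalar
    family a. *)
Lemma lpnormZr {R : realType} {k : scalar_kind} {N : nat}
    {X : normedModType (scalar_field R k)} {p : \bar R} (p1 : (1 <= p)%E)
    (a : 'I_N -> scalar_field R k) (x : X) :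
  lpnorm p (fun n => a n *: x) = lpnorm p a * rnorm x.
Proof.
have rx : rnorm (sreal k (rnorm x)) = rnorm x.
  by rewrite rnormE; apply: (can_inj (@srealK R k)); rewrite !rnormE normr_id.
rewrite mulrC -rx.
rewrite (@eq_lpnorm _ _ _ _ (scalar_field R k)^o p a
  [ffun n => a n : (scalar_field R k)^o]); last by move=> n; rewrite ffunE.
rewrite -lpnormZ //; apply: eq_lpnorm => n.
by rewrite !ffunE !rnormZ rx mulrC.
Qed.

Lemma rnorm_le_lpnorm {R : realType} {k : scalar_kind} {N : nat}
    {E : normedZmodType (scalar_field R k)} {p : \bar R} (p1 : (1 <= p)%E)
    (f : 'I_N -> E) (n : 'I_N) : rnorm (f n) <= lpnorm p f.
Proof.
case: p p1 => [r| |] //= r1; last exact: (le_bigmax _ (fun n => rnorm (f n))).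
have r0 : 0 < r by rewrite lee_fin in r1; exact: lt_le_trans r1.
have -> : rnorm (f n) = (rnorm (f n) `^ r) `^ r^-1.
  by rewrite -powRrM mulfV ?gt_eqF// powRr1 ?rnorm_ge0.
apply: ge0_ler_powR; rewrite ?invr_ge0 ?nnegrE ?(ltW r0) ?powR_ge0//.
  by apply: sumr_ge0 => i _; exact: powR_ge0.
by rewrite (bigD1 n) //= lerDl sumr_ge0 // => i _; exact: powR_ge0.
Qed.

(** Each of the N terms is at most ||f||_p. The constant N is sharp at
    p = oo; for continuity any constant serves. *)
Lemma lpnorm1_le {R : realType} {k : scalar_kind} {N : nat}
    {E : normedZmodType (scalar_field R k)} {p : \bar R} (p1 : (1 <= p)%E)
    (f : 'I_N -> E) : lpnorm 1%E f <= N%:R * lpnorm p f.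
Proof.
rewrite lpnorm1E (le_trans (ler_sum _ (fun n _ => rnorm_le_lpnorm p1 f n))) //.
by rewrite sumr_const card_ord mulr_natl.
Qed.

Lemma ler_lpnorm_sum {R : realType} {k : scalar_kind} {N : nat}
    {X : normedModType (scalar_field R k)} {p : \bar R} (p1 : (1 <= p)%E)
    {I : finType} (F : I -> {ffun 'I_N -> X}) :
  lpnorm p (\sum_i F i) <= \sum_i lpnorm p (F i).
Proof.
elim/big_rec2: _ => [|i s g _ gs]; first by rewrite lpnorm0.
by rewrite (le_trans (ler_lpnormD p1 _ _)) // lerD2l.
Qed.

(** * Matrices acting on vector-valued signals *)

(** Bounds on operators are obtained in R, while the norms of the spaces, and so
    the constants in the continuity criterion, live in the scalar field. *)
Lemma bounded_linear_map_continuous {R : realType} {k : scalar_kind}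
    {E F : normedModType (scalar_field R k)} (T : E -> F) (C : R) :
  linear T -> (forall x, rnorm (T x) <= C * rnorm x) -> continuous T.
Proof.
move=> linT TC.
pose L : {linear E -> F} := HB.pack T (GRing.isLinear.Build _ _ _ _ T linT).
apply: (@bounded_linear_continuous _ _ _ L); apply/linear_boundedP.
have nrmC (M : scalar_field R k) x : sreal k C <= M -> `|T x| <= M * `|x|.
  move=> CM; apply: (@le_trans _ _ (sreal k C * `|x|)).
    by rewrite -!rnormE -srealM ler_sreal.
  by rewrite ler_wpM2r.
near=> M; move=> x; apply: nrmC.
by near: M; apply: nbhs_pinfty_ge;
   rewrite realE -(sreal0 R k) !ler_sreal le_total.
Unshelve. all: by end_near. Qed.

Section MatrixAction.
Context {R : realType} {k : scalar_kind} {N : nat}.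
Context {X : normedModType (scalar_field R k)}.
Local Notation K := (scalar_field R k).
Implicit Types (A B : 'M[K]_N) (f : {ffun 'I_N -> X}).

Definition mxact A f : {ffun 'I_N -> X} := [ffun i => \sum_j A i j *: f j].

Lemma mxact_linear A : linear (mxact A).
Proof.
move=> a f g; apply/ffunP => i; rewrite !ffunE scaler_sumr -big_split.
by apply: eq_bigr => j _; rewrite !ffunE scalerDr !scalerA mulrC.
Qed.

Lemma mxactM A B f : mxact (A *m B) f = mxact A (mxact B f).
Proof.
apply/ffunP => i; rewrite !ffunE.
under eq_bigr do rewrite mxE scaler_suml.
rewrite exchange_big; apply: eq_bigr => j _.
by rewrite ffunE scaler_sumr; apply: eq_bigr => l _; rewrite scalerA.
Qed.

Lemma mxact1 f : mxact 1%:M f = f.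
Proof.
apply/ffunP => i; rewrite ffunE (bigD1 i) //= mxE eqxx scale1r big1 ?addr0 //.
by move=> j ji; rewrite mxE eq_sym (negPf ji) scale0r.
Qed.

(** The decomposition that makes L^1 the natural source space: each value f(j)
    only feeds column j of A. *)
Lemma mxact_cols A f :
  mxact A f = \sum_j [ffun i => A i j *: f j].
Proof.
apply/ffunP => i; rewrite ffunE sum_ffunE.
by apply: eq_bigr => j _; rewrite ffunE.
Qed.

Lemma kappa_ge0 (q : \bar R) A : 0 <= kappa q A.
Proof. exact: bigmax_ge_id. Qed.

(** Triangle inequality over the columns of A, each of which has norm at most
    [kappa q A]. *)
Lemma lpnorm_mxact {q : \bar R} (q1 : (1 <= q)%E) A f :
  lpnorm q (mxact A f) <= kappa q A * lpnorm 1%E f.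
Proof.
rewrite mxact_cols (le_trans (ler_lpnorm_sum q1 _)) // lpnorm1E mulr_sumr.
apply: ler_sum => j _.
rewrite (@eq_lpnorm _ _ _ _ _ _ _ (fun i => A i j *: f j)); last first.
  by move=> i; rewrite ffunE.
rewrite lpnormZr // ler_wpM2r ?rnorm_ge0 //.
exact: (le_bigmax _ (fun j => lpnorm q (fun n => A n j))).
Qed.

Lemma mxact_continuous {p q : \bar R} (p1 : (1 <= p)%E) (q1 : (1 <= q)%E) A :
  continuous (mxact A : Lp N X p1 -> Lp N X q1).
Proof.
apply: (@bounded_linear_map_continuous _ _ _ _ _ (kappa q A * N%:R)).
  exact: mxact_linear.
move=> f; rewrite !rnorm_Lp (le_trans (lpnorm_mxact q1 A f)) //.
by rewrite -mulrA ler_wpM2l ?kappa_ge0 ?lpnorm1_le.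
Qed.

(** The inverse is the action of B, which is continuous for the same reason as
    the action of A. *)
Lemma mxact_topological_isomorphism {p q : \bar R}
    (p1 : (1 <= p)%E) (q1 : (1 <= q)%E) A B :
  A *m B = 1%:M ->
  topological_isomorphism (mxact A : Lp N X p1 -> Lp N X q1).
Proof.
move=> AB; split; [exact: mxact_linear | exact: mxact_continuous |].
exists (mxact B); split=> [f|f|].
- by rewrite -mxactM (mulmx1C AB) mxact1.
- by rewrite -mxactM AB mxact1.
- exact: mxact_continuous.
Qed.

(** The upper bound is [lpnorm_mxact]. For the lower bound, a signal that is a
    unit vector e at j and 0 elsewhere has norm 1 in L^1 and is sent to column j
    of A scaled by e, whose norm is that of column j. *)
Lemma opnorm_mxact {q : \bar R} (q1 : (1 <= q)%E) A :
  (exists x : X, x != 0) ->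
  opnorm (mxact A : Lp N X (lexx 1%E) -> Lp N X q1) = (kappa q A)%:E.
Proof.
move=> [x x0]; apply/eqP; rewrite eq_le; apply/andP; split.
  apply: ge_ereal_sup => _ [f /= f1 <-]; rewrite lee_fin !rnorm_Lp in f1 *.
  by rewrite (le_trans (lpnorm_mxact q1 A f)) // ler_piMr ?kappa_ge0.
pose e : X := `|x|^-1 *: x.
have e1 : rnorm e = 1.
  rewrite /rnorm normrZ normfV normr_id mulVf ?normr_eq0 //.
  by case: (k).
(* The supremum dominates 0 and every column norm, hence their maximum. *)
rewrite /kappa; elim/big_ind: _ => [|a b ax bx|j _].
- apply: ereal_sup_ubound; exists 0 => /=; first by rewrite rnorm_Lp lpnorm0.
  by rewrite rnorm_Lp (_ : mxact A 0 = 0) ?lpnorm0 //; apply/ffunP => i;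
     rewrite !ffunE big1 // => l _; rewrite ffunE scaler0.
- by rewrite /Num.max; case: ifP.
- pose d : {ffun 'I_N -> X} := [ffun i => if i == j then e else 0].
  apply: ereal_sup_ubound; exists d => /=.
    rewrite rnorm_Lp lpnorm1E (bigD1 j) //= ffunE eqxx e1 big1 ?addr0 //.
    by move=> i /negPf ij; rewrite ffunE ij rnorm0.
  rewrite rnorm_Lp -[lpnorm q (fun n => A n j)]mulr1 -e1 -lpnormZr //.
  congr (_ %:E); apply: eq_lpnorm => i; congr (rnorm _).
  rewrite ffunE (bigD1 j) //= ffunE eqxx big1 ?addr0 // => l /negPf lj.
  by rewrite ffunE lj scaler0.
Qed.

End MatrixAction.

(** * Coherence and unitary matrices *)

Section Coherence.
Context {R : realType} {k : scalar_kind} {N : nat}.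
Local Notation K := (scalar_field R k).
Implicit Types (A B : 'M[K]_N).

Lemma rnorm_sconj (a : K) : rnorm (sconj a) = rnorm a.
Proof.
by rewrite /rnorm; case: (k) a => //= a;
   exact: (congr1 (@complex.Re R) (normcJ a)).
Qed.

Lemma sqr_rnorm (a : K) : sreal k (rnorm a ^+ 2) = a * sconj a.
Proof.
rewrite expr2 srealM rnormE -expr2; case: (k) a => /= a; last exact: sqr_normc.
by rewrite real_normK ?num_real // expr2.
Qed.

Lemma rnorm_le_coherence A n j : rnorm (A n j) <= coherence A.
Proof.
apply: le_trans (le_bigmax _ (fun n => \big[Num.max/0]_j rnorm (A n j)) n).
exact: (le_bigmax _ (fun j => rnorm (A n j))).
Qed.

Lemma kappa_infty A : kappa +oo%E A <= coherence A.
Proof.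
apply/bigmax_leP; split=> [|j _]; first exact: bigmax_ge_id.
apply/bigmax_leP; split=> [|n _]; first exact: bigmax_ge_id.
exact: rnorm_le_coherence.
Qed.

Lemma coherence_adjoint A : coherence (adjoint A) <= coherence A.
Proof.
apply/bigmax_leP; split=> [|j _]; first exact: bigmax_ge_id.
apply/bigmax_leP; split=> [|n _]; first exact: bigmax_ge_id.
by rewrite !mxE rnorm_sconj rnorm_le_coherence.
Qed.

Lemma adjointK : involutive (@adjoint R k N).
Proof.
move=> A; apply/matrixP => i j; rewrite !mxE.
by case: (k) A => //= A; rewrite conjcK.
Qed.

(** The diagonal entries of A^* A are the squared euclidean norms of the columns
    of A. *)
Lemma kappa2_le1 A : adjoint A *m A = 1%:M -> kappa 2%:E A <= 1.
Proof.
move=> AA; apply/bigmax_leP; split=> // j _ /=.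
rewrite (_ : \sum_n _ = 1) ?powR1 //; apply: (can_inj (@srealK R k)).
transitivity ((adjoint A *m A) j j); last first.
  by rewrite AA mxE eqxx; case: (k).
rewrite mxE (big_morph (sreal k) (@srealD R k) (sreal0 R k)).
apply: eq_bigr => n _; rewrite !mxE mulrC -sqr_rnorm.
by rewrite -[2]/(2%:R) powR_mulrn ?rnorm_ge0.
Qed.

Lemma adjoint_basis_matrixK (u : 'I_N -> 'cV[K]_N) :
  orthonormal_basis u -> adjoint (basis_matrix u) *m basis_matrix u = 1%:M.
Proof.
move=> [_ uu]; apply/matrixP => i j; rewrite [RHS]mxE eq_sym -uu !mxE.
by apply: eq_bigr => n _; rewrite !mxE mulrC.
Qed.

Lemma gftE (X : normedModType K) (u : 'I_N -> 'cV[K]_N) :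
  @gft R k N X u = mxact (adjoint (basis_matrix u)).
Proof.
apply/funext => f; apply/ffunP => j; rewrite !ffunE.
by apply: eq_bigr => n _; rewrite !mxE.
Qed.

End Coherence.

Theorem theorem2p2 (R : realType) (k : scalar_kind) (N : nat) (hN : (0 < N)%N)
    (u : 'I_N -> 'cV[scalar_field R k]_N) (hu : orthonormal_basis u)
    (X : completeNormedModType (scalar_field R k)) (hX : exists x : X, x != 0)
    (q : \bar R) (hq : (1 <= q)%E) :
  let U := basis_matrix u in
  [/\ forall f : {ffun 'I_N -> X},
        lpnorm q (gft u f) <= kappa q (adjoint U) * lpnorm 1%E f /\
        lpnorm q f <= kappa q U * lpnorm 1%E (gft u f),
      forall f : {ffun 'I_N -> X},
        [/\ lpnorm +oo%E (gft u f) <= coherence U * lpnorm 1%E f,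
            lpnorm +oo%E f <= coherence U * lpnorm 1%E (gft u f),
            lpnorm 2%:E (gft u f) <= lpnorm 1%E f &
            lpnorm 2%:E f <= lpnorm 1%E (gft u f)],
      topological_isomorphism (gft u : Lp N X (lexx 1%E) -> Lp N X hq) &
      opnorm (gft u : Lp N X (lexx 1%E) -> Lp N X hq)
        = (kappa q (adjoint U))%:E].
Proof.
move=> U; rewrite gftE -/U.
have VU : adjoint U *m U = 1%:M by exact: adjoint_basis_matrixK.
have UV := mulmx1C VU.
(* f is recovered from its transform by the action of U. *)
have inv p (p1 : (1 <= p)%E) (f : {ffun 'I_N -> X}) :
    lpnorm p f <= kappa p U * lpnorm 1%E (mxact (adjoint U) f).
  by rewrite -{1}[f]mxact1 -UV mxactM; exact: lpnorm_mxact.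
have two : (1 <= 2%:E :> \bar R)%E by rewrite lee_fin ler1n.
have step (a b c x : R) : 0 <= x -> a <= b * x -> b <= c -> a <= c * x.
  by move=> x0 ab bc; rewrite (le_trans ab) // ler_wpM2r.
split=> [f|f||].
- by split; [exact: lpnorm_mxact | exact: inv].
- split.
  + apply: (step _ _ _ _ (lpnorm_ge0 _ _) (lpnorm_mxact (leey _) _ _)).
    exact: le_trans (kappa_infty _) (coherence_adjoint _).
  + exact: (step _ _ _ _ (lpnorm_ge0 _ _) (inv _ (leey _) _) (kappa_infty _)).
  + rewrite -[leRHS]mul1r.
    apply: (step _ _ _ _ (lpnorm_ge0 _ _) (lpnorm_mxact two _ _)).
    by apply: kappa2_le1; rewrite adjointK.
  + rewrite -[leRHS]mul1r.
    exact: (step _ _ _ _ (lpnorm_ge0 _ _) (inv _ two _) (kappa2_le1 _ VU)).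
- exact: mxact_topological_isomorphism VU.
- exact: opnorm_mxact.
Qed.
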